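(* Let $n,k$ be positive integers with $1\le k\le n$. 1. When $k=1$, we have $B_{n,k}(t)=BE_{n,k}(t)$ and $B_{n,-k}(t)=BE_{n,-k}(t)$. 2. When $2\le k\le n$, we have $B_{n,k}(t)=BE_{n,-k}(t)$ and $B_{n,-k}(t)=BE_{n,k}(t)$.
   Context: $\mathfrak{B}_n$ is the group of signed permutations: permutations $\pi$ of $\{\pm1,\dots,\pm n\}$ with $\pi(-i)=-\pi(i)$; write $\pi_i=\pi(i)$ and $\pi_0=0$. For $\pi\in\mathfrak{B}_n$, $$\mathrm{des}_B(\pi)=|\{i\in\{0,1,\dots,n-1\}:\pi_i>\pi_{i+1}\}|,$$ $$\mathrm{exc}_B(\pi)=|\{i\in[n]:\pi_{|\pi_i|}>\pi_i\}|+|\{i\in[n]:\pi_i=-i\}|,$$ where $[n]=\{1,\dots,n\}$ and comparisons use the usual order on $\mathbb{Z}$. For $k\in\{\pm1,\dots,\pm n\}$ let $\mathfrak{B}_{n,k}=\{\pi\in\mathfrak{B}_n:\pi_1=k\}$, and set $$B_{n,k}(t)=\sum_{\pi\in\mathfrak{B}_{n,k}}t^{\mathrm{des}_B(\pi)},\qquad BE_{n,k}(t)=\sum_{\pi\in\mathfrak{B}_{n,k}}t^{\mathrm{exc}_B(\pi)}.$$ *)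

(* Defs.v *)
From mathcomp Require Import all_boot all_order all_fingroup all_algebra.

Set Implicit Arguments.
Unset Strict Implicit.
Unset Printing Implicit Defensive.

Import Order.TTheory GRing.Theory Num.Theory.
Local Open Scope ring_scope.

(* The set {1, -1, ..., n, -n}: (b, i) stands for i + 1 if b = false and for
   - (i + 1) if b = true; [sval_int] is this identification with integers. *)
Definition sidx (n : nat) : finType := (bool * 'I_n)%type.

Definition sval_int (n : nat) (x : sidx n) : int :=
  (-1) ^+ x.1 * (x.2.+1)%:Z.

Definition sopp (n : nat) (x : sidx n) : sidx n := (~~ x.1, x.2).

Lemma sval_int_opp (n : nat) (x : sidx n) : sval_int (sopp x) = - sval_int x.
Proof. by case: x => [[] i]; rewrite /sval_int /= !(expr0, expr1) ?mulN1r ?opprK !mul1r. Qed.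

Lemma sval_int_inj (n : nat) : injective (@sval_int n).
Proof.
move=> [[] i] [[] j]; rewrite /sval_int /= !(expr0, expr1) ?mulN1r ?mul1r //.
- by move=> /oppr_inj [] /val_inj ->.
- by move=> [] /val_inj ->.
Qed.

Lemma sval_int_surj (n : nat) (z : int) :
  (1 <= `|z| <= n)%N -> exists x : sidx n, sval_int x = z.
Proof.
case: z => [[|m]|m] //= lt_mn.
- by exists (false, Ordinal (lt_mn : (m < n)%N)); rewrite /sval_int expr0 mul1r.
- by exists (true, Ordinal (lt_mn : (m < n)%N)); rewrite /sval_int expr1 mulN1r NegzE.
Qed.

Definition signed_perms (n : nat) : {set {perm sidx n}} :=
  [set pi : {perm sidx n} | [forall x, pi (sopp x) == sopp (pi x)]].

(* pi_i as an integer, for 0 <= i <= n, with the convention pi_0 = 0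
   (the value for i > n is junk and is never used below). *)
Definition entry (n : nat) (pi : {perm sidx n}) (i : nat) : int :=
  if i is j.+1 then oapp (fun j : 'I_n => sval_int (pi (false, j))) 0 (insub j)
  else 0.

Definition desB (n : nat) (pi : {perm sidx n}) : nat :=
  #|[set i : 'I_n | entry pi i > entry pi i.+1]|.

(* An element i : 'I_n represents the index i.+1 of [n] = {1, ..., n}. *)
Definition excB (n : nat) (pi : {perm sidx n}) : nat :=
  (#|[set i : 'I_n | (entry pi `|entry pi i.+1|%N > entry pi i.+1)%R]|
   + #|[set i : 'I_n | entry pi i.+1 == - (i.+1)%:Z]|)%N.

Definition signed_perms_first (n : nat) (k : int) : {set {perm sidx n}} :=
  [set pi in signed_perms n | entry pi 1 == k].

Definition Bpoly (n : nat) (k : int) : {poly int} :=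
  \sum_(pi in signed_perms_first n k) 'X^(desB pi).

Definition BEpoly (n : nat) (k : int) : {poly int} :=
  \sum_(pi in signed_perms_first n k) 'X^(excB pi).

(* Main.v *)
Require Import Defs.
From mathcomp Require Import all_boot all_order all_fingroup all_algebra.
From mathcomp Require Import zify.
Import Order.TTheory GRing.Theory Num.Theory.
Local Open Scope ring_scope.
Set Implicit Arguments.
Unset Strict Implicit.
Unset Printing Implicit Defensive.

(** Foata's fundamental transformation for signed words. Cut the word
    [w_1 ... w_n] after each right-to-left minimum of [|w_1| ... |w_n|], read
    every block as a cycle of signed letters, negate the letters of the blocks of
    length at least 2, and let [pi] send the absolute value of each letter to the
    next letter of its cycle. Then [exc_B pi] counts the cyclic descents of the
    blocks of [w], a one-letter block counting when its letter is negative. A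
    letter [x] at the beginning of a block follows, in [0 w_1 ... w_n] as well as
    in its cycle, a letter of smaller absolute value (or itself), so that in both
    cases it is counted exactly when [x < 0]; hence [exc_B pi = des_B w]. The
    first block ends with [1] or [-1] and starts with [w_1], so [pi_1 = - w_1],
    unless the block has length 1, in which case [pi_1 = w_1]. *)

Section SignedPairs.

Variable n : nat.
Implicit Types (q : {perm 'I_n}) (s : {ffun 'I_n -> bool}).

(** [q] acts on absolute values and [s i] is the sign of the image of the positive letter; adding
    signs modulo 2 makes the map odd. *)
Definition signed_fun q s (x : sidx n) : sidx n := (x.1 (+) s x.2, q x.2).

Lemma signed_fun_inj q s : injective (signed_fun q s).
Proof. by move=> [b i] [c j] [/= + /perm_inj eij]; rewrite eij => /addIb ->. Qed.

Definition signed_of (p : {perm 'I_n} * {ffun 'I_n -> bool}) : {perm sidx n} :=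
  perm (@signed_fun_inj p.1 p.2).

Lemma signed_ofE q s b i : signed_of (q, s) (b, i) = (b (+) s i, q i).
Proof. by rewrite permE. Qed.

Lemma signed_of_inj : injective signed_of.
Proof.
move=> [q1 s1] [q2 s2] e12.
have e i : (s1 i, q1 i) = (s2 i, q2 i).
  by have /permP/(_ (false, i)) := e12; rewrite !signed_ofE.
by congr (_, _); [apply/permP|apply/ffunP] => i; case: (e i).
Qed.

Lemma signed_permsE : signed_perms n = [set signed_of p | p in setT].
Proof.
apply/setP => w; apply/idP/imsetP => [|[[q s] _ ->]]; last first.
  by rewrite inE; apply/forallP => -[b i]; rewrite !signed_ofE /sopp /= addNb.
rewrite inE => /forallP w_odd.
have wE b i : w (b, i) = (b (+) (w (false, i)).1, (w (false, i)).2).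
  case: b; last by rewrite addFb -surjective_pairing.
  by have /eqP := w_odd (false, i); rewrite /sopp /= => ->.
have q_inj : injective (fun i => (w (false, i)).2).
  move=> i j eq_ij; suff : w ((w (false, i)).1, i) = w ((w (false, j)).1, j).
    by move/perm_inj => [].
  by rewrite wE addbb [RHS]wE addbb eq_ij.
exists (perm q_inj, [ffun i => (w (false, i)).1]) => //.
by apply/permP => -[b i]; rewrite signed_ofE wE permE ffunE.
Qed.

Lemma entry_signed_of q s (i : 'I_n) :
  entry (signed_of (q, s)) i.+1 = sval_int (s i, q i).
Proof. by rewrite /= valK /= signed_ofE. Qed.

End SignedPairs.

Lemma absz_sval_int n (x : sidx n) : `|sval_int x|%N = x.2.+1.
Proof. by case: x => [[] i]; rewrite /sval_int /= ?expr0 ?expr1; lia. Qed.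

Lemma sval_int_lt0 n (x : sidx n) : (sval_int x < 0) = x.1.
Proof. by case: x => [[] i]; rewrite /sval_int /= ?expr0 ?expr1; lia. Qed.

Lemma card_set_sum (T : finType) (P : pred T) : #|[set x | P x]| = (\sum_x P x)%N.
Proof.
by rewrite -sum1_card big_mkcond; apply: eq_bigr => x _; rewrite inE; case: (P x).
Qed.

Section Foata.

Variable n : nat.
Implicit Types (q : {perm 'I_n}) (s : {ffun 'I_n -> bool}) (a : 'I_n).

(** Position [0] qualifies vacuously; any other [a] does when position [a - 1] holds a right-to-left
    minimum. *)
Definition block_start q a :=
  [forall i : 'I_n, (i.+1 == a) ==> [forall j : 'I_n, (a <= j) ==> (q i < q j)]]%N.

(* The position preceding [a] in its cycle. If [a] starts a block, this is the
   last position of the block, the first right-to-left minimum from [a] on, which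
   is the minimum of all the letters from [a] on. *)
Definition block_pred_fun q a : 'I_n :=
  if block_start q a then [arg min_(j < a | (a <= j)%N) (q j : nat)]
  else insubd a a.-1.

Variant block_pred_spec q a : 'I_n -> Prop :=
  | BlockStart (e : 'I_n) of block_start q a & (a <= e)%N
      & (forall j : 'I_n, (a <= j)%N -> (q e <= q j)%N)
      & (forall i : 'I_n, i.+1 = a -> forall j : 'I_n, (a <= j)%N -> (q i < q j)%N) :
      block_pred_spec q a e
  | BlockInner (i : 'I_n) of ~~ block_start q a & i.+1 = a
      & (exists2 j : 'I_n, (a <= j)%N & (q j < q i)%N) : block_pred_spec q a i.

Lemma block_pred_funP q a : block_pred_spec q a (block_pred_fun q a).
Proof.
rewrite /block_pred_fun; case: ifPn => [st|nst].
  case: arg_minnP => // e le_ae min_e; apply: BlockStart => // i ia j le_aj.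
  by have /forallP/(_ i) := st; rewrite ia eqxx => /forallP/(_ j); rewrite le_aj.
have := nst; rewrite negb_forall => /existsP[i]; rewrite negb_imply.
case/andP => /eqP ia; rewrite negb_forall => /existsP[j]; rewrite negb_imply.
case/andP => le_aj; rewrite -leqNgt => le_q.
have -> : insubd a a.-1 = i.
  by apply: val_inj; rewrite -ia val_insubd /= ltn_ord.
apply: BlockInner => //; exists j => //; rewrite ltn_neqAle le_q andbT.
by apply: contraTneq le_aj => /val_inj/perm_inj ->; rewrite -ia ltnn.
Qed.

Lemma block_pred_fun_inj q : injective (block_pred_fun q).
Proof.
have start_lt (a b : 'I_n) : (a < b)%N -> block_pred_fun q a != block_pred_fun q b.
  move=> lt_ab; apply/eqP.
  have lt_n : (b.-1 < n)%N by have := ltn_ord b; lia.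
  have eb : (Ordinal lt_n).+1 = b by rewrite /=; lia.
  case: block_pred_funP => [e _ le_ae min_a _|i _ ia [j le_aj lt_j]];
    case: block_pred_funP => [f _ le_bf min_b sep|k _ kb [l le_bl lt_l]] eq_ef;
    subst.
  (* Two block starts: position [b - 1] is at or after [a] and has a smaller value than the common
     predecessor, against its minimality. *)
  - have := sep _ eb _ le_bf; have /= := min_a (Ordinal lt_n); lia.
  - by have := min_a l; lia.
  - lia.
  - lia.
move=> a b e; apply/val_inj/eqP; case: ltngtP => // /start_lt; rewrite e ?eqxx //.
Qed.

Definition block_pred q : {perm 'I_n} := perm (@block_pred_fun_inj q).

Lemma block_predP q a : block_pred_spec q a (block_pred q a).
Proof. by rewrite permE; exact: block_pred_funP. Qed.

(** [rho a] is the absolute value preceding the letter at [a] in its cycle, so [rho^-1 * q] passes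
    to the next one; signs flip exactly outside one-letter blocks. *)
Definition foata (p : {perm 'I_n} * {ffun 'I_n -> bool}) :=
  let rho := (block_pred p.1 * p.1)%g in
  ((rho^-1 * p.1)%g,
   [ffun j => p.2 (rho^-1 j)%g (+) (block_pred p.1 (rho^-1 j)%g != rho^-1 j)%g]).

Lemma foata1E q s a : (foata (q, s)).1 (q (block_pred q a)) = q a.
Proof. by rewrite /= permM -[q (block_pred q a)]permM permK. Qed.

Lemma foata2E q s a :
  (foata (q, s)).2 (q (block_pred q a)) = s a (+) (block_pred q a != a).
Proof. by rewrite /= ffunE -[q (block_pred q a)]permM permK. Qed.

Lemma entry_foata q s a :
  entry (signed_of (foata (q, s))) (q (block_pred q a)).+1 =
  sval_int (s a (+) (block_pred q a != a), q a).
Proof.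
by rewrite [foata _]surjective_pairing entry_signed_of foata1E foata2E.
Qed.

(* The absolute value preceding [w_a] in its cycle is determined by the letters
   before position [a] and by the set of the absolute values that remain, so
   that [w] can be read off its image from left to right. *)
Lemma block_pred_prefix q1 q2 a :
  (forall i : 'I_n, (i < a)%N -> q1 i = q2 i) ->
  q1 (block_pred q1 a) = q2 (block_pred q2 a).
Proof.
move=> eq12.
have transfer (r1 r2 : {perm 'I_n}) : (forall i : 'I_n, (i < a)%N -> r1 i = r2 i) ->
    forall j : 'I_n, (a <= j)%N -> exists2 j' : 'I_n, (a <= j')%N & r2 j' = r1 j.
  move=> eq_r j le_aj; exists ((r2^-1)%g (r1 j)); last by rewrite permKV.
  rewrite leqNgt; apply/negP => lt_a; have := eq_r _ lt_a; rewrite permKV.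
  by move=> /perm_inj ej; move: lt_a; rewrite ej ltnNge le_aj.
have t12 := transfer _ _ eq12.
have t21 := transfer _ _ (fun i lt_ia => esym (eq12 i lt_ia)).
(* Equal sets of remaining values have the same minimum and agree on whether a block starts at [a],
   so the mixed cases are absurd. *)
case: block_predP => [e _ le_ae min_e sep|i _ ia [j le_aj lt_j]];
  case: block_predP => [f _ le_af min_f sep'|k _ ka [l le_al lt_l]].
- apply: val_inj; have [e' le_e' eqe] := t12 _ le_ae.
  have [f' le_f' eqf] := t21 _ le_af.
  by have := min_f _ le_e'; have := min_e _ le_f'; rewrite eqe eqf /=; lia.
- have [l' le_l' eql] := t21 _ le_al; have := sep _ ka _ le_l'.
  by rewrite eql eq12 -?ka //; lia.
- have [j' le_j' eqj] := t12 _ le_aj; have := sep' _ ia _ le_j'.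
  by rewrite eqj -eq12 -?ia //; lia.
- by rewrite eq12 -?ia //; congr (q2 _); apply: val_inj => /=; lia.
Qed.

Lemma foata_inj : injective foata.
Proof.
move=> [q1 s1] [q2 s2] e12.
have eqm m (a : 'I_n) : (a < m)%N -> (s1 a, q1 a) = (s2 a, q2 a).
  elim: m a => // m IHm a; rewrite ltnS => le_am.
  have pre (i : 'I_n) : (i < a)%N -> q1 i = q2 i.
    by move=> lt_ia; have [_ ->] := IHm i (leq_trans lt_ia le_am).
  have eqr := block_pred_prefix pre.
  have eqq : q1 a = q2 a by rewrite -(foata1E q1 s1) -(foata1E q2 s2) eqr e12.
  have := foata2E q1 s1 a; rewrite eqr e12 foata2E.
  (* A one-letter block means [q (block_pred q a) = q a], the same condition for both words, so the
     sign changes agree. *)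
  rewrite -[block_pred q1 a == a](inj_eq (@perm_inj _ q1)) eqr eqq.
  by rewrite (inj_eq perm_inj) => /addIb ->.
by congr (_, _); [apply/permP|apply/ffunP] => i; case: (eqm n i (ltn_ord i)).
Qed.

Lemma foata_excB q s :
  excB (signed_of (foata (q, s))) =
  (\sum_(a < n) (if block_pred q a == a then s a else
     sval_int (s a, q a) < sval_int (s (block_pred q a), q (block_pred q a)))%R)%N.
Proof.
pose r := block_pred q.
have r_eq (a : 'I_n) : (r (r a) == r a) = (r a == a) by rewrite (inj_eq perm_inj).
rewrite /excB !card_set_sum.
(* At index [q (r (r a))] the excedance test compares the letters at [r a] and [a]; at [q (r a)] the
   other test concerns the letter at [a]. *)
rewrite (reindex_inj (inj_comp (@perm_inj _ q)
                       (inj_comp (@perm_inj _ r) (@perm_inj _ r)))).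
rewrite [X in (_ + X)%N](reindex_inj (inj_comp (@perm_inj _ q) (@perm_inj _ r))).
rewrite -big_split; apply: eq_bigr => a _.
rewrite -/(r _) -[(q \o (r \o r)) a]/(q (r (r a))) -[(q \o r) a]/(q (r a)).
rewrite !entry_foata absz_sval_int entry_foata -/r r_eq.
have [ra|ra] := eqVneq (r a) a.
  rewrite !ra /= ltxx !addbF add0n /sval_int /=; congr nat_of_bool.
  by case: (s a); rewrite ?expr0 ?expr1; case: eqP => //; lia.
rewrite /= !addbT -![(~~ s _, q _)]/(sopp (s _, q _)) !sval_int_opp ltrN2.
suff -> : (- sval_int (s a, q a) == - (q (r a)).+1%:Z) = false.
  by rewrite addn0; case: (_ < _).
rewrite eqr_opp; apply: contraNF ra => /eqP /(congr1 absz).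
by rewrite absz_sval_int => -[/val_inj/perm_inj <-].
Qed.

Lemma foata_excB_desB p : excB (signed_of (foata p)) = desB (signed_of p).
Proof.
case: p => q s; rewrite foata_excB /desB card_set_sum; apply: eq_bigr => a _.
have lt_sign (i : 'I_n) :
    (q i < q a)%N -> (sval_int (s a, q a) < sval_int (s i, q i)) = s a.
  by rewrite /sval_int /=; case: (s a); case: (s i); rewrite ?expr0 ?expr1; lia.
rewrite entry_signed_of; congr nat_of_bool.
case: block_predP => [e _ le_ae min_e sep|i _ ia _].
  transitivity (s a).
    have [//|ne_ea] := eqVneq e a; apply: lt_sign.
    rewrite ltn_neqAle min_e // andbT.
    by apply: contra ne_ea => /eqP/val_inj/perm_inj ->.
  (* For [a = 0] the preceding entry is the conventional [0]; otherwise it ends the previous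
     block. *)
  have [a0|a_gt0] := posnP a; first by rewrite a0 /= sval_int_lt0.
  have lt_n : (a.-1 < n)%N by have := ltn_ord a; lia.
  have ea : (Ordinal lt_n).+1 = a by rewrite /=; lia.
  by rewrite -[in RHS]ea entry_signed_of lt_sign // sep.
rewrite -[in RHS]ia entry_signed_of ifN_eq //; apply/eqP => eia.
by move: ia; rewrite eia; lia.
Qed.

End Foata.

Lemma foata_first n (p : {perm 'I_n.+1} * {ffun 'I_n.+1 -> bool}) :
  entry (signed_of (foata p)) 1 =
  if `|entry (signed_of p) 1|%N == 1%N then entry (signed_of p) 1
  else - entry (signed_of p) 1.
Proof.
case: p => q s.
(* The first block ends at the overall minimum, encoded by [ord0], so the initial letter follows
   absolute value 1 in its cycle. *)
have q0 : q (block_pred q ord0) = ord0.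
  case: block_predP => [e _ _ min_e _|i _ //].
  have := min_e ((q^-1)%g ord0) (leq0n _); rewrite permKV leqn0 => /eqP.
  by move=> qe0; apply: val_inj.
have := entry_foata q s ord0; rewrite q0 => ->.
rewrite (entry_signed_of q s ord0) absz_sval_int /= eqSS.
rewrite -(inj_eq (@perm_inj _ q)) q0 -val_eqE eq_sym /=.
case: ifP => _; first by rewrite addbF.
by rewrite addbT -[(~~ _, _)]/(sopp (s ord0, q ord0)) sval_int_opp.
Qed.

Lemma sum_signed_perms_first n k (F : {perm sidx n} -> {poly int}) :
  \sum_(w in signed_perms_first n k) F w =
  \sum_(p | entry (signed_of p) 1 == k) F (signed_of p).
Proof.
rewrite (eq_bigl (fun w => (w \in signed_perms n) && (entry w 1 == k))); last first.
  by move=> w; rewrite inE.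
rewrite big_mkcondr signed_permsE big_imset /=; last first.
  by move=> x y _ _; apply: signed_of_inj.
by rewrite [RHS]big_mkcond; apply: eq_bigl => p; rewrite inE.
Qed.

Lemma Bpoly_BEpoly n (k : int) :
  Bpoly n.+1 k = BEpoly n.+1 (if `|k|%N == 1%N then k else - k).
Proof.
rewrite /Bpoly /BEpoly !sum_signed_perms_first.
(* On a finite type the injective [foata] is a bijection. *)
rewrite [RHS](reindex_inj (@foata_inj n.+1)); apply: eq_big => [p|p _].
  rewrite foata_first; case: ifP; case: ifP => //; last by rewrite eqr_opp.
  - by move=> k1 e1; apply/eqP/eqP => e; lia.
  - by move=> k1 e1; apply/eqP/eqP => e; lia.
by rewrite foata_excB_desB.
Qed.

Theorem corollary6 (n k : nat) (hk : (1 <= k <= n)%N) :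
  (k = 1%N ->
     Bpoly n k%:Z = BEpoly n k%:Z /\ Bpoly n (- k%:Z) = BEpoly n (- k%:Z))
  /\
  ((2 <= k <= n)%N ->
     Bpoly n k%:Z = BEpoly n (- k%:Z) /\ Bpoly n (- k%:Z) = BEpoly n k%:Z).
Proof.
case: n hk => [|n] hk; first by case: k hk => [|[]].
split=> [-> | /andP[k_gt1 _]]; first by rewrite !Bpoly_BEpoly.
by rewrite !Bpoly_BEpoly abszN absz_nat gtn_eqF // opprK.
Qed.
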